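(* Let $(A,\cdot,\Phi=\{\partial_1,\partial_2\})$ be a commutative differential algebra and $(A,\Delta,\Psi=\{\eth_1,\eth_2\})$ be a cocommutative differential coalgebra. Let $(A,[\ ,\ ],\cdot)$ be the induced Poisson algebra of $(A,\cdot,\Phi)$ and $(A,\delta,\Delta)$ be the induced Poisson coalgebra of $(A,\Delta,\Psi)$, that is, $$[a,b]=\partial_1(a)\cdot\partial_2(b)-\partial_2(a)\cdot\partial_1(b),\qquad\delta=(\eth_1\otimes\eth_2-\eth_2\otimes\eth_1)\Delta.$$ Suppose that $(A,\cdot,\Delta,\Phi,\Psi)$ is a commutative and cocommutative differential ASI bialgebra. Put $S:=\eth_2\partial_1-\eth_1\partial_2$. Then $(A,[\ ,\ ],\cdot,\delta,\Delta)$ is a Poisson bialgebra if and only if the following two equations hold for all $a,b\in A$: $$(\mathrm{id}\otimes L_A(b)-L_A(b)\otimes\mathrm{id})(S\otimes\mathrm{id})\Delta(a)+(L_A(S(a))\otimes\mathrm{id})\Delta(b)=0,$$ and \begin{align*} &(\mathrm{ad}_A(a)\otimes S-S\otimes\mathrm{ad}_A(a))\Delta(b)-(\mathrm{ad}_A(b)\otimes S-S\otimes\mathrm{ad}_A(b))\Delta(a)\\ &-(L_A(S(a))\otimes S-S\otimes L_A(S(a)))\Delta(b)+(L_A(S(b))\otimes S-S\otimes L_A(S(b)))\Delta(a)\\ &+(L_A(S(a))\otimes\mathrm{id}+\mathrm{id}\otimes L_A(S(a)))(\eth_1\otimes\eth_2-\eth_2\otimes\eth_1)\Delta(b)\\ &-(L_A(S(b))\otimes\mathrm{id}+\mathrm{id}\otimes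 L_A(S(b)))(\eth_1\otimes\eth_2-\eth_2\otimes\eth_1)\Delta(a)=0. \end{align*} In particular, if $\eth_2(\partial_1(a))\cdot b=\eth_1(\partial_2(a))\cdot b$ for all $a,b\in A$ and $(\eth_2\partial_1\otimes\mathrm{id})\Delta=(\eth_1\partial_2\otimes\mathrm{id})\Delta$, then $(A,[\ ,\ ],\cdot,\delta,\Delta)$ is a Poisson bialgebra.
   Context: All vector spaces and algebras are finite-dimensional over a field $\mathbb F$ of characteristic $0$; ''algebra'' means associative algebra, not necessarily unital. $\sigma(a\otimes b)=b\otimes a$, $\tau(a\otimes b\otimes c)=c\otimes a\otimes b$. $L_A(a)b=a\cdot b$, $\mathrm{ad}_A(a)b=[a,b]$. Commutative differential algebra $(A,\cdot,\{\partial_1,\partial_2\})$: $(A,\cdot)$ a commutative algebra with commuting derivations $\partial_1,\partial_2$. Cocommutative differential coalgebra $(A,\Delta,\{\eth_1,\eth_2\})$: $\Delta$ is coassociative (counit not required), $\Delta=\sigma\Delta$, and $\eth_1,\eth_2$ are commuting with $\Delta\eth_k=(\eth_k\otimes\mathrm{id}+\mathrm{id}\otimes\eth_k)\Delta$. Commutative and cocommutative ASI bialgebra $(A,\cdot,\Delta)$: $(A,\cdot)$ commutative algebra, $(A,\Delta)$ cocommutative coassociative coalgebra, with $\Delta(a\cdot b)=(L_A(b)\otimes\mathrm{id})\Delta(a)+(\mathrm{id}\otimes L_A(a))\Delta(b)$ and $(L_A(a)\otimes\mathrm{id}-\mathrm{id}\otimes L_A(a))\Delta(b)=\sigma((\mathrm{id}\otimes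 L_A(b)-L_A(b)\otimes\mathrm{id})\Delta(a))$. $(A,\cdot,\Delta,\Phi,\Psi)$ is a commutative and cocommutative differential ASI bialgebra if moreover $(A,\cdot,\Phi)$ is a commutative differential algebra, $(A,\Delta,\Psi)$ is a cocommutative differential coalgebra, and for $k=1,2$ and $a,b\in A$: $\eth_k(a)\cdot b=a\cdot\partial_k(b)+\eth_k(a\cdot b)$, $a\cdot\eth_k(b)=\partial_k(a)\cdot b+\eth_k(a\cdot b)$, $(\partial_k\otimes\mathrm{id})\Delta=(\mathrm{id}\otimes\eth_k)\Delta+\Delta\partial_k$, $(\mathrm{id}\otimes\partial_k)\Delta=(\eth_k\otimes\mathrm{id})\Delta+\Delta\partial_k$. Poisson algebra $(A,[\ ,\ ],\cdot)$: $(A,[\ ,\ ])$ a Lie algebra, $(A,\cdot)$ a commutative algebra, $[a,b\cdot c]=[a,b]\cdot c+b\cdot[a,c]$. Lie coalgebra $(A,\delta)$: $\delta=-\sigma\delta$ and $(\mathrm{id}+\tau+\tau^2)(\mathrm{id}\otimes\delta)\delta=0$. Poisson coalgebra $(A,\delta,\Delta)$: $(A,\delta)$ a Lie coalgebra, $(A,\Delta)$ a cocommutative coassociative coalgebra, and $(\mathrm{id}\otimes\Delta)\delta(a)=(\delta\otimes\mathrm{id})\Delta(a)+(\sigma\otimes\mathrm{id})(\mathrm{id}\otimes\delta)\Delta(a)$. Poisson bialgebra $(A,[\ ,\ ],\cdot,\delta,\Delta)$: $(A,[\ ,\ ],\cdot)$ is a Poisson algebra, $(A,\delta,\Delta)$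 is a Poisson coalgebra, $(A,[\ ,\ ],\delta)$ is a Lie bialgebra, i.e. $\delta([a,b])=(\mathrm{ad}_A(a)\otimes\mathrm{id}+\mathrm{id}\otimes\mathrm{ad}_A(a))\delta(b)-(\mathrm{ad}_A(b)\otimes\mathrm{id}+\mathrm{id}\otimes\mathrm{ad}_A(b))\delta(a)$, $(A,\cdot,\Delta)$ is a commutative and cocommutative ASI bialgebra, and $$\delta(a\cdot b)=(L_A(a)\otimes\mathrm{id})\delta(b)+(L_A(b)\otimes\mathrm{id})\delta(a)+(\mathrm{id}\otimes\mathrm{ad}_A(a))\Delta(b)+(\mathrm{id}\otimes\mathrm{ad}_A(b))\Delta(a),$$ $$\Delta([a,b])=(\mathrm{ad}_A(a)\otimes\mathrm{id}+\mathrm{id}\otimes\mathrm{ad}_A(a))\Delta(b)+(L_A(b)\otimes\mathrm{id}-\mathrm{id}\otimes L_A(b))\delta(a).$$ *)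

(* Defs.v *)
From HB Require Import structures.
From mathcomp Require Import all_boot all_algebra.

Set Implicit Arguments.
Unset Strict Implicit.
Unset Printing Implicit Defensive.

Import GRing.Theory VectorInternalTheory.
Local Open Scope ring_scope.

(* Tensor products of finite-dimensional vector spaces, modelled on coordinate
   matrices.  Every operation below is characterised on pure tensors, which
   determine a linear map ([tens_ext]); [tliftE] is the universal property. *)

Section Tensor.
Variable F : fieldType.
Implicit Types U V W : vectType F.

Definition tens U V : vectType F := 'M[F]_(dim U, dim V).

Definition pure U V (u : U) (v : V) : tens U V := (v2r u)^T *m v2r v.

Definition tbase U (i : 'I_(dim U)) : U := r2v (delta_mx 0 i).

(* The linear extension of f from the basis tensors; meaningful when f is
   bilinear. *)
Definition tlift U V W (f : U -> V -> W) : 'Hom(tens U V, W) :=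
  linfun (fun t : tens U V =>
    \sum_i \sum_j t i j *: f (tbase i) (tbase j)).

Definition tmap U V U' V' (f : 'Hom(U, U')) (g : 'Hom(V, V')) :
    'Hom(tens U V, tens U' V') :=
  tlift (fun u v => pure (f u) (g v)).

Definition tswap U V : 'Hom(tens U V, tens V U) :=
  tlift (fun u v => pure v u).

Definition tassoc U V W : 'Hom(tens U (tens V W), tens (tens U V) W) :=
  tlift (fun u => tlift (fun v w => pure (pure u v) w)).

(* (u (x) v) (x) w |-> (w (x) u) (x) v *)
Definition trot U : 'Hom(tens (tens U U) U, tens (tens U U) U) :=
  (tassoc U U U \o tswap (tens U U) U)%VF.

Lemma tlift_linear U V W (f : U -> V -> W) :
  linear (fun t : tens U V => \sum_i \sum_j t i j *: f (tbase i) (tbase j)).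
Proof.
move=> a s t; rewrite scaler_sumr -big_split /=; apply: eq_bigr => i _.
rewrite scaler_sumr -big_split /=; apply: eq_bigr => j _.
by rewrite !mxE scalerDl scalerA.
Qed.

Lemma tlift_coef U V W (f : U -> V -> W) (t : tens U V) :
  tlift f t = \sum_i \sum_j t i j *: f (tbase i) (tbase j).
Proof.
pose f' t' := \sum_i \sum_j (t' : tens U V) i j *: f (tbase i) (tbase j).
pose L := GRing.isLinear.Build F _ W _ f' (tlift_linear f).
pose fL : {linear tens U V -> W} := HB.pack f' L.
exact: (lfunE fL t).
Qed.

Lemma tbase_expand U (u : U) : u = \sum_i v2r u 0 i *: tbase i.
Proof.
rewrite -{1}(v2rK u) {1}(row_sum_delta (v2r u)) linear_sum.
by apply: eq_bigr => i _; rewrite linearZ.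
Qed.

Lemma pureE U V (u : U) (v : V) i j : pure u v i j = v2r u 0 i * v2r v 0 j.
Proof. by rewrite mxE big_ord1 mxE. Qed.

Lemma pure_linearr U V (u : U) : linear (pure u : V -> tens U V).
Proof. by move=> a v w; rewrite /pure linearP mulmxDr -scalemxAr. Qed.

Lemma pure_linearl U V (v : V) : linear (fun u : U => pure u v).
Proof. by move=> a u w; rewrite /pure !linearP mulmxDl -scalemxAl. Qed.

Lemma linear_expand U W (f : U -> W) (u : U) : linear f ->
  f u = \sum_i v2r u 0 i *: f (tbase i).
Proof.
move=> fl; pose L := GRing.isLinear.Build F U W _ f fl.
pose fL : {linear U -> W} := HB.pack f L.
rewrite {1}(tbase_expand u) -[f _]/(fL _) linear_sum.
by apply: eq_bigr => i _; rewrite linearZ.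
Qed.

Lemma tliftE U V W (f : U -> V -> W) :
    (forall u, linear (f u)) -> (forall v, linear (fun u => f u v)) ->
  forall u v, tlift f (pure u v) = f u v.
Proof.
move=> fr fl u v; rewrite tlift_coef (linear_expand u (fl v)).
apply: eq_bigr => i _; rewrite (linear_expand v (fr _)) scaler_sumr.
by apply: eq_bigr => j _; rewrite pureE scalerA.
Qed.

Lemma tens_expand U V (t : tens U V) :
  t = \sum_i \sum_j t i j *: pure (tbase i) (tbase j).
Proof.
rewrite {1}[LHS]matrix_sum_delta; apply: eq_bigr => i _; apply: eq_bigr => j _.
congr (_ *: _); apply/matrixP=> k l.
by rewrite pureE /tbase !r2vK !mxE !eqxx /= -natrM mulnb.
Qed.

Lemma tens_ext U V W (f g : 'Hom(tens U V, W)) :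
  (forall u v, f (pure u v) = g (pure u v)) -> f = g.
Proof.
move=> fg; apply/lfunP => t; rewrite (tens_expand t) !linear_sum.
apply: eq_bigr => i _; rewrite !linear_sum; apply: eq_bigr => j _.
by rewrite !linearZ /= fg.
Qed.

Lemma tmapE U V U' V' (f : 'Hom(U, U')) (g : 'Hom(V, V')) u v :
  tmap f g (pure u v) = pure (f u) (g v).
Proof.
rewrite tliftE // => [x|y] a b c; rewrite linearP;
  [exact: pure_linearr | exact: pure_linearl].
Qed.

Lemma tswapE U V (u : U) (v : V) : tswap U V (pure u v) = pure v u.
Proof.
by rewrite tliftE // => [x|y]; [exact: pure_linearl | exact: pure_linearr].
Qed.

Lemma tassocE U V W (u : U) (v : V) (w : W) :
  tassoc U V W (pure u (pure v w)) = pure (pure u v) w.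
Proof.
have liftE (u' : U) v' w' :
    tlift (fun (v : V) (w : W) => pure (pure u' v) w) (pure v' w') =
    pure (pure u' v') w'.
  rewrite tliftE // => [x|y]; first exact: pure_linearr.
  by move=> a b c; rewrite pure_linearr pure_linearl.
rewrite tliftE ?liftE // => [x|t] a b c; first by rewrite linearP.
rewrite !tlift_coef scaler_sumr -big_split /=; apply: eq_bigr => i _.
rewrite scaler_sumr -big_split /=; apply: eq_bigr => j _.
by rewrite !pure_linearl scalerDr !scalerA mulrC.
Qed.

Lemma trotE U (u v w : U) :
  trot U (pure (pure u v) w) = pure (pure w u) v.
Proof. by rewrite comp_lfunE tswapE tassocE. Qed.

End Tensor.

(* A bilinear product on A is a linear map A -> End(A), so that [mul a] is
   literally the left multiplication L_A(a), and [br a] is ad_A(a). *)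

Section Structures.
Variables (F : fieldType) (A : vectType F).
Local Notation AA := (tens A A).
Local Notation Id := (\1%VF : 'End(A)).
Implicit Types (mul br : 'Hom(A, 'End(A))) (Delta delta : 'Hom(A, AA)).
Implicit Types d e : 'End(A).

Record is_comm_algebra mul : Prop := {
  calg_comm : forall a b, mul a b = mul b a;
  calg_assoc : forall a b c, mul (mul a b) c = mul a (mul b c) }.

Definition is_derivation mul d : Prop :=
  forall a b, d (mul a b) = mul (d a) b + mul a (d b).

Record is_comm_diff_algebra mul d1 d2 : Prop := {
  cdalg_alg : is_comm_algebra mul;
  cdalg_der1 : is_derivation mul d1;
  cdalg_der2 : is_derivation mul d2;
  cdalg_comm : (d1 \o d2)%VF = (d2 \o d1)%VF }.

Record is_cocomm_coalgebra Delta : Prop := {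
  ccoalg_cocomm : forall a, Delta a = tswap A A (Delta a);
  ccoalg_coassoc : forall a,
    tmap Delta Id (Delta a) = tassoc A A A (tmap Id Delta (Delta a)) }.

Definition is_coderivation Delta e : Prop :=
  forall a, Delta (e a) = (tmap e Id + tmap Id e) (Delta a).

Record is_cocomm_diff_coalgebra Delta e1 e2 : Prop := {
  cdcoalg_coalg : is_cocomm_coalgebra Delta;
  cdcoalg_coder1 : is_coderivation Delta e1;
  cdcoalg_coder2 : is_coderivation Delta e2;
  cdcoalg_comm : (e1 \o e2)%VF = (e2 \o e1)%VF }.

Record is_ASI_bialgebra mul Delta : Prop := {
  asi_alg : is_comm_algebra mul;
  asi_coalg : is_cocomm_coalgebra Delta;
  asi_compat1 : forall a b,
    Delta (mul a b) = tmap (mul b) Id (Delta a) + tmap Id (mul a) (Delta b);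
  asi_compat2 : forall a b,
    (tmap (mul a) Id - tmap Id (mul a)) (Delta b) =
    tswap A A ((tmap Id (mul b) - tmap (mul b) Id) (Delta a)) }.

Record diff_compat mul Delta d e : Prop := {
  dc_left : forall a b, mul (e a) b = mul a (d b) + e (mul a b);
  dc_right : forall a b, mul a (e b) = mul (d a) b + e (mul a b);
  dc_coleft : forall a,
    tmap d Id (Delta a) = tmap Id e (Delta a) + Delta (d a);
  dc_coright : forall a,
    tmap Id d (Delta a) = tmap e Id (Delta a) + Delta (d a) }.

Record is_diff_ASI_bialgebra mul Delta d1 d2 e1 e2 : Prop := {
  dasi_asi : is_ASI_bialgebra mul Delta;
  dasi_alg : is_comm_diff_algebra mul d1 d2;
  dasi_coalg : is_cocomm_diff_coalgebra Delta e1 e2;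
  dasi_compat1 : diff_compat mul Delta d1 e1;
  dasi_compat2 : diff_compat mul Delta d2 e2 }.

Record is_Lie_algebra br : Prop := {
  lie_alt : forall a, br a a = 0;
  lie_jacobi : forall a b c,
    br a (br b c) + br b (br c a) + br c (br a b) = 0 }.

Record is_Poisson_algebra br mul : Prop := {
  poisson_lie : is_Lie_algebra br;
  poisson_alg : is_comm_algebra mul;
  poisson_leibniz : forall a b c,
    br a (mul b c) = mul (br a b) c + mul b (br a c) }.

Record is_Lie_coalgebra delta : Prop := {
  lieco_anti : forall a, delta a = - tswap A A (delta a);
  lieco_jacobi : forall a,
    (\1 + trot A + (trot A \o trot A))%VF
      (tassoc A A A (tmap Id delta (delta a))) = 0 }.

Record is_Poisson_coalgebra delta Delta : Prop := {
  poissonco_lie : is_Lie_coalgebra delta;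
  poissonco_coalg : is_cocomm_coalgebra Delta;
  poissonco_coleibniz : forall a,
    tassoc A A A (tmap Id Delta (delta a)) =
    tmap delta Id (Delta a) +
    tmap (tswap A A) Id (tassoc A A A (tmap Id delta (Delta a))) }.

Record is_Lie_bialgebra br delta : Prop := {
  liebi_alg : is_Lie_algebra br;
  liebi_coalg : is_Lie_coalgebra delta;
  liebi_cocycle : forall a b,
    delta (br a b) =
    (tmap (br a) Id + tmap Id (br a)) (delta b) -
    (tmap (br b) Id + tmap Id (br b)) (delta a) }.

Record is_Poisson_bialgebra br mul delta Delta : Prop := {
  pbi_alg : is_Poisson_algebra br mul;
  pbi_coalg : is_Poisson_coalgebra delta Delta;
  pbi_lie : is_Lie_bialgebra br delta;
  pbi_asi : is_ASI_bialgebra mul Delta;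
  pbi_delta_mul : forall a b,
    delta (mul a b) =
    tmap (mul a) Id (delta b) + tmap (mul b) Id (delta a) +
    tmap Id (br a) (Delta b) + tmap Id (br b) (Delta a);
  pbi_Delta_br : forall a b,
    Delta (br a b) =
    (tmap (br a) Id + tmap Id (br a)) (Delta b) +
    (tmap (mul b) Id - tmap Id (mul b)) (delta a) }.

Definition induced_bracket mul d1 d2 : 'Hom(A, 'End(A)) :=
  linfun (fun a => ((mul (d1 a) \o d2) - (mul (d2 a) \o d1))%VF).

Lemma induced_bracketE mul d1 d2 a b :
  induced_bracket mul d1 d2 a b = mul (d1 a) (d2 b) - mul (d2 a) (d1 b).
Proof.
pose f a := ((mul (d1 a) \o d2) - (mul (d2 a) \o d1))%VF.
have fl : linear f.
  move=> k x y.
  rewrite /f !linearP !comp_lfunDl -!comp_lfunZl opprD scalerBr.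
  by rewrite addrACA.
pose L := GRing.isLinear.Build F A 'End(A) _ f fl.
pose fL : {linear A -> 'End(A)} := HB.pack f L.
rewrite /induced_bracket -[X in linfun X]/(fL : A -> _) (lfunE fL).
by rewrite /= /f !lfunE /= !lfunE /= !comp_lfunE.
Qed.

Definition induced_cobracket Delta e1 e2 : 'Hom(A, AA) :=
  ((tmap e1 e2 - tmap e2 e1) \o Delta)%VF.

End Structures.

(* Main.v *)
From HB Require Import structures.
Require Import Defs.
From mathcomp Require Import all_boot all_algebra.
From mathcomp Require Import ring.

Import GRing.Theory VectorInternalTheory.
Local Open Scope ring_scope.

Set Implicit Arguments.
Unset Strict Implicit.
Unset Printing Implicit Defensive.

(** The induced bracket always makes A a Poisson algebra, and the induced
    cobracket always makes it a Poisson coalgebra.  For the coalgebra the point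
    is that the iterated coproduct of a cocommutative coassociative coalgebra is
    a symmetric 3-tensor: both coalgebra axioms become cancellations between
    operators f (x) g (x) h applied to that tensor, with f, g, h products of
    the commuting coderivations e1, e2 ([induced_Poisson_coalgebra]).

    What is left are the three compatibilities between products and
    coproducts: for delta (a b), for Delta [a, b] and for delta [a, b].  Write
    L_u for multiplication by u, and p^l = p (x) id, p^r = id (x) p.  The
    differential ASI axioms say that
      - L_u e = e L_u + L_(d u), so the operators e can be moved to the left;
      - d^l Delta = e^r Delta + Delta d and d^r Delta = e^l Delta + Delta d, so
        every d next to a coproduct can be traded for an e or moved into it;
      - (L_u^l - L_u^r) Delta w is symmetric in u and w.
    By these rules every term becomes a word in the operators e applied to
    L_u^l Delta w or L_u^r Delta w, with u and w differential expressions in a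
    and b.  In these normal forms the defects of the first two compatibilities
    are both minus the left-hand side of the first displayed equation of the
    theorem ([cobracket_mul_defect], [coproduct_bracket_defect]), and the defect
    of the third is minus that of the second one ([cobracket_bracket_defect]).
    All three are identities, so the equivalence is immediate; if L_(S a) and
    S^l Delta vanish, so do both equations ([defects_vanish]). *)

(** * Tensor calculus *)

Section Tensor.
Variable F : fieldType.
Implicit Types U V W X : vectType F.

(** Coordinates separate vectors, so an identity between formal combinations of
    vectors may be checked in the commutative ring F. *)
Lemma vect_ext V (x y : V) :
  (forall phi : V -> F, {morph phi : u v / u + v} -> {morph phi : u / - u} ->
    phi 0 = 0 -> phi x = phi y) -> x = y.
Proof.
move=> xy; rewrite (coord_vbasis (memvf x)) (coord_vbasis (memvf y)).
apply: eq_bigr => i _; congr (_ *: _).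
by apply: (xy (coord _ i)) => [u v|u|]; rewrite (linearD, linearN, linear0).
Qed.

(** Unlike [linearD] and [linearN], these two rules leave canonical instances in
    the form in which a vector space over F is elaborated, so that equal terms
    stay syntactically equal. *)
Lemma lfunD U V (f : 'Hom(U, V)) x y : f (x + y) = f x + f y.
Proof. exact: linearD. Qed.

Lemma lfunN U V (f : 'Hom(U, V)) x : f (- x) = - f x.
Proof. exact: linearN. Qed.

Lemma eq_on_pure U V W (f g : 'Hom(tens U V, W)) :
  (forall u v, f (pure u v) = g (pure u v)) -> f =1 g.
Proof. by move=> fg t; rewrite (tens_ext fg). Qed.

Lemma tmap_comp U V U' V' U'' V'' (f : 'Hom(U', U'')) (g : 'Hom(V', V''))
    (f' : 'Hom(U, U')) (g' : 'Hom(V, V')) t :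
  tmap f g (tmap f' g' t) = tmap (f \o f') (g \o g') t.
Proof.
rewrite -comp_lfunE; apply: eq_on_pure => u v.
by rewrite comp_lfunE !tmapE !comp_lfunE.
Qed.

Lemma tmapDl U V U' V' (f f' : 'Hom(U, U')) (g : 'Hom(V, V')) t :
  tmap (f + f') g t = tmap f g t + tmap f' g t.
Proof.
rewrite -add_lfunE; apply: eq_on_pure => u v.
by rewrite add_lfunE !tmapE add_lfunE /pure !linearD mulmxDl.
Qed.

Lemma tmapDr U V U' V' (f : 'Hom(U, U')) (g g' : 'Hom(V, V')) t :
  tmap f (g + g') t = tmap f g t + tmap f g' t.
Proof.
rewrite -add_lfunE; apply: eq_on_pure => u v.
by rewrite add_lfunE !tmapE add_lfunE /pure !linearD.
Qed.

Lemma tmapNl U V U' V' (f : 'Hom(U, U')) (g : 'Hom(V, V')) t :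
  tmap (- f) g t = - tmap f g t.
Proof.
rewrite -opp_lfunE; apply: eq_on_pure => u v.
by rewrite opp_lfunE !tmapE opp_lfunE /pure !linearN mulNmx.
Qed.

Lemma tmapNr U V U' V' (f : 'Hom(U, U')) (g : 'Hom(V, V')) t :
  tmap f (- g) t = - tmap f g t.
Proof.
rewrite -opp_lfunE; apply: eq_on_pure => u v.
by rewrite opp_lfunE !tmapE opp_lfunE /pure !linearN.
Qed.

Lemma tswap_tmap U V U' V' (f : 'Hom(U, U')) (g : 'Hom(V, V')) t :
  tswap _ _ (tmap f g t) = tmap g f (tswap _ _ t).
Proof.
rewrite -!comp_lfunE; apply: eq_on_pure => u v.
by rewrite !comp_lfunE tmapE !tswapE tmapE.
Qed.

Lemma eq_on_pure3 U V W X (f g : 'Hom(tens U (tens V W), X)) :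
  (forall u v w, f (pure u (pure v w)) = g (pure u (pure v w))) -> f =1 g.
Proof.
move=> fg; apply: eq_on_pure => u t.
pose pu : 'Hom(tens V W, tens U (tens V W)) :=
  linfun (mulmx (v2r u)^T \o v2r).
have puE s : pu s = pure u s by rewrite lfunE.
rewrite -puE -!comp_lfunE; apply: eq_on_pure => v w.
by rewrite !comp_lfunE puE fg.
Qed.

Lemma tassoc_tmap U V W U' V' W' (f : 'Hom(U, U')) (g : 'Hom(V, V'))
    (h : 'Hom(W, W')) t :
  tassoc _ _ _ (tmap f (tmap g h) t) = tmap (tmap f g) h (tassoc _ _ _ t).
Proof.
rewrite -!comp_lfunE; apply: eq_on_pure3 => u v w.
by rewrite !comp_lfunE !tmapE !tassocE !tmapE.
Qed.

Lemma tswap12_tmap U (f g h : 'End(U)) t :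
  tmap (tswap U U) \1 (tmap (tmap f g) h t) =
  tmap (tmap g f) h (tmap (tswap U U) \1 t).
Proof.
rewrite !tmap_comp comp_lfun1l comp_lfun1r; congr (tmap _ _ _).
by apply/lfunP => z; rewrite !comp_lfunE tswap_tmap.
Qed.

Lemma trot_tmap U (f g h : 'End(U)) t :
  trot U (tmap (tmap f g) h t) = tmap (tmap h f) g (trot U t).
Proof. by rewrite !comp_lfunE tswap_tmap tassoc_tmap. Qed.
End Tensor.

(** [constr_eq] identifies occurrences of a vector that differ only in universe
    levels; [generalize] would separate them. *)
Ltac name_atom x :=
  first
    [ match goal with y := ?z |- _ => constr_eq x z; change x with y end
    | let y := fresh in pose y := x; change x with y ].

Ltac name_atoms t :=
  lazymatch t with
  | (?u + ?v)%R => name_atoms u; name_atoms v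
  | (- ?u)%R => name_atoms u
  | 0%R => idtac
  | ?x => name_atom x
  end.

(** Identities of abelian groups, in a vector space. *)
Ltac abel :=
  lazymatch goal with |- ?x = ?y => name_atoms x; name_atoms y end;
  repeat match goal with y := _ |- _ => clearbody y end;
  let phi := fresh in
  let phiD := fresh in let phiN := fresh in let phi0 := fresh in
  apply: vect_ext => phi phiD phiN phi0; rewrite ?(phiD, phiN, phi0); ring.

(** The two commuting actions of End(A) on A (x) A.  They are locked so that
    unification never compares f (x) id with id (x) g by expanding both into
    coordinate matrices. *)
HB.lock Definition lft (F : fieldType) (A : vectType F) (f : 'End(A)) :
  'End(tens A A) := tmap f \1.

HB.lock Definition rgt (F : fieldType) (A : vectType F) (f : 'End(A)) :
  'End(tens A A) := tmap \1 f.

Section Actions.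
Variables (F : fieldType) (A : vectType F).
Implicit Types (f g : 'End(A)) (t : tens A A).

Lemma lftE f : lft f = tmap f \1. Proof. by rewrite lft.unlock. Qed.
Lemma rgtE f : rgt f = tmap \1 f. Proof. by rewrite rgt.unlock. Qed.

Lemma tmap_lft_rgt f g t : tmap f g t = lft f (rgt g t).
Proof. by rewrite lftE rgtE tmap_comp comp_lfun1r comp_lfun1l. Qed.

Lemma lft_rgtC f g t : rgt g (lft f t) = lft f (rgt g t).
Proof. by rewrite lftE rgtE !tmap_comp !comp_lfun1r !comp_lfun1l. Qed.

Lemma lftM f g t : lft (f \o g)%VF t = lft f (lft g t).
Proof. by rewrite !lftE tmap_comp comp_lfun1l. Qed.

Lemma rgtM f g t : rgt (f \o g)%VF t = rgt f (rgt g t).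
Proof. by rewrite !rgtE tmap_comp comp_lfun1l. Qed.

Lemma lftD f g t : lft (f + g) t = lft f t + lft g t.
Proof. by rewrite !lftE tmapDl. Qed.

Lemma lftN f t : lft (- f) t = - lft f t.
Proof. by rewrite !lftE tmapNl. Qed.

Lemma rgtD f g t : rgt (f + g) t = rgt f t + rgt g t.
Proof. by rewrite !rgtE tmapDr. Qed.

Lemma rgtN f t : rgt (- f) t = - rgt f t.
Proof. by rewrite !rgtE tmapNr. Qed.
End Actions.

(** * The induced Poisson coalgebra *)

Section Coalgebra.
Variables (F : fieldType) (A : vectType F).
Variables (D : 'Hom(A, tens A A)) (e1 e2 : 'End(A)).
Hypothesis hC : is_cocomm_diff_coalgebra D e1 e2.
Local Notation delta := (induced_cobracket D e1 e2).
Local Notation Id := (\1%VF : 'End(A)).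
Local Notation T a := (tassoc A A A (tmap Id D (D a))).

Let hD : is_cocomm_coalgebra D := cdcoalg_coalg hC.

(** The next two lemmas say that the iterated coproduct T a is invariant under
    all permutations of its three factors. *)
Lemma trot_coproduct a : trot A (T a) = T a.
Proof.
by rewrite -{1}(ccoalg_coassoc hD) comp_lfunE tswap_tmap -(ccoalg_cocomm hD).
Qed.

Lemma tswap_coproduct a : tmap (tswap A A) Id (T a) = T a.
Proof.
rewrite -(ccoalg_coassoc hD) tmap_comp comp_lfun1l.
congr (tmap _ _ _); apply/lfunP => x.
by rewrite comp_lfunE -(ccoalg_cocomm hD).
Qed.

Lemma tassoc_tmap_coproduct f g h a :
  tassoc A A A (tmap f (tmap g h \o D) (D a)) = tmap (tmap f g) h (T a).
Proof. by rewrite -tassoc_tmap tmap_comp comp_lfun1r. Qed.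

Lemma cobracketE a : delta a = tmap e1 e2 (D a) - tmap e2 e1 (D a).
Proof. by rewrite comp_lfunE add_lfunE opp_lfunE. Qed.

Lemma tassoc_tmap_coder f e a : is_coderivation D e ->
  tassoc A A A (tmap f (D \o e)%VF (D a)) =
  tmap (tmap f e) Id (T a) + tmap (tmap f Id) e (T a).
Proof.
move=> he; rewrite -!tassoc_tmap_coproduct -linearD -tmapDr.
congr (_ (tmap _ _ _)).
by apply/lfunP => x; rewrite !(add_lfunE, comp_lfunE) he add_lfunE.
Qed.

Lemma tassoc_tmap_cobracket f a :
  tassoc A A A (tmap f delta (D a)) =
  tmap (tmap f e1) e2 (T a) - tmap (tmap f e2) e1 (T a).
Proof.
rewrite -!tassoc_tmap_coproduct -linearB -tmapNr -tmapDr.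
by rewrite /induced_cobracket comp_lfunDl comp_lfunNl.
Qed.

Lemma tassoc_tmap_cobracket_comp f e a : is_coderivation D e ->
  tassoc A A A (tmap f (delta \o e)%VF (D a)) =
  tmap (tmap f (e1 \o e)) e2 (T a) + tmap (tmap f e1) (e2 \o e) (T a)
  - tmap (tmap f (e2 \o e)) e1 (T a) - tmap (tmap f e2) (e1 \o e) (T a).
Proof.
move=> he; rewrite -!tassoc_tmap_coproduct -linearD -!linearB -!tmapNr -!tmapDr.
congr (_ (tmap _ _ _)); apply/lfunP => x.
rewrite !(add_lfunE, opp_lfunE, comp_lfunE) he add_lfunE !linearD /=.
rewrite !tmap_comp !comp_lfun1r; abel.
Qed.

Lemma cobracketC a : delta a = - tswap A A (delta a).
Proof.
by rewrite cobracketE linearB /= !tswap_tmap -(ccoalg_cocomm hD); abel.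
Qed.

(** Co-Jacobi is the cancellation that proves the Jacobi identity for the wedge
    of two commuting derivations: on the symmetric tensor T a, rotating f (x) g
    (x) h only permutes the three operators. *)
Lemma induced_Poisson_coalgebra : is_Poisson_coalgebra delta D.
Proof.
have [h1 h2] := (cdcoalg_coder1 hC, cdcoalg_coder2 hC).
split=> //; first split; first exact: cobracketC.
- move=> a; rewrite cobracketE linearB /= !tmap_comp !comp_lfun1l.
  rewrite linearB /= !tassoc_tmap_cobracket_comp //.
  rewrite !(add_lfunE, id_lfunE) (comp_lfunE (trot A)).
  rewrite !(linearB (trot A)) !(linearD (trot A)) /=.
  rewrite !trot_tmap !trot_coproduct (cdcoalg_comm hC).
  abel.
- move=> a; rewrite cobracketE linearB /= !tmap_comp !comp_lfun1l.
  rewrite linearB /= !tassoc_tmap_coder //.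
  rewrite tassoc_tmap_cobracket linearB /= !tswap12_tmap tswap_coproduct.
  have -> : tmap delta Id (D a) =
      tmap (tmap e1 e2) Id (T a) - tmap (tmap e2 e1) Id (T a).
    rewrite -(ccoalg_coassoc hD) !tmap_comp -tmapNl -tmapDl comp_lfun1l.
    by rewrite /induced_cobracket comp_lfunDl comp_lfunNl.
  abel.
Qed.
End Coalgebra.

(** * The induced Poisson algebra *)

Section Algebra.
Variables (F : fieldType) (A : vectType F).
Variables (mul : 'Hom(A, 'End(A))) (d1 d2 : 'End(A)).
Hypothesis hA : is_comm_diff_algebra mul d1 d2.
Local Notation br := (induced_bracket mul d1 d2).

Let mulC := calg_comm (cdalg_alg hA).
Let mulA := calg_assoc (cdalg_alg hA).

Lemma mul_rot a b c : mul a (mul b c) = mul b (mul c a).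
Proof. by rewrite mulC mulA. Qed.

Lemma mulCA a b c : mul a (mul b c) = mul b (mul a c).
Proof. by rewrite -!mulA (mulC a). Qed.

Lemma derC a : d2 (d1 a) = d1 (d2 a).
Proof. by rewrite -!comp_lfunE (cdalg_comm hA). Qed.

Lemma mulDl a b c : mul (a + b) c = mul a c + mul b c.
Proof. by rewrite linearD add_lfunE. Qed.

Lemma mulNl a b : mul (- a) b = - mul a b.
Proof. by rewrite linearN opp_lfunE. Qed.

Lemma mulDr a b c : mul a (b + c) = mul a b + mul a c.
Proof. exact: lfunD. Qed.

Lemma mulNr a b : mul a (- b) = - mul a b.
Proof. exact: lfunN. Qed.

Lemma bracket_bracket a b c :
  br a (br b c) =
    mul (d1 a) (mul (d1 (d2 b)) (d2 c)) + mul (d1 a) (mul (d1 b) (d2 (d2 c)))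
  - mul (d1 a) (mul (d2 (d2 b)) (d1 c)) - mul (d1 a) (mul (d2 b) (d1 (d2 c)))
  - mul (d2 a) (mul (d1 (d1 b)) (d2 c)) - mul (d2 a) (mul (d1 b) (d1 (d2 c)))
  + mul (d2 a) (mul (d1 (d2 b)) (d1 c)) + mul (d2 a) (mul (d2 b) (d1 (d1 c))).
Proof.
rewrite !induced_bracketE !(lfunD d1, lfunD d2, lfunN d1, lfunN d2).
rewrite !(cdalg_der1 hA, cdalg_der2 hA) !derC !(mulDr, mulNr); abel.
Qed.

Lemma induced_Poisson_algebra : is_Poisson_algebra br mul.
Proof.
split; [split | exact: cdalg_alg hA |].
- by move=> a; rewrite induced_bracketE mulC subrr.
- move=> a b c; rewrite !bracket_bracket.
  (* Every product of three factors is put in the order a, b, c. *)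
  rewrite -!(mul_rot _ (d1 b), mul_rot _ (d2 b)).
  rewrite !(mul_rot (d1 c), mul_rot (d2 c)).
  abel.
- move=> a b c; rewrite !induced_bracketE (cdalg_der1 hA) (cdalg_der2 hA).
  rewrite !(mulDl, mulNl, mulDr, mulNr) !mulA.
  rewrite (mulCA b (d1 a)) (mulCA b (d2 a)); abel.
Qed.
End Algebra.


(** * Normal forms in a differential ASI bialgebra *)

Section Bialgebra.
Variables (F : fieldType) (A : vectType F).
Variables (mul : 'Hom(A, 'End(A))) (d1 d2 : 'End(A)).
Variables (D : 'Hom(A, tens A A)) (e1 e2 : 'End(A)).
Hypothesis hB : is_diff_ASI_bialgebra mul D d1 d2 e1 e2.
Local Notation br := (induced_bracket mul d1 d2).
Local Notation delta := (induced_cobracket D e1 e2).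
Local Notation S := ((e2 \o d1) - (e1 \o d2))%VF.

Let hASI : is_ASI_bialgebra mul D := dasi_asi hB.
Let h1 : diff_compat mul D d1 e1 := dasi_compat1 hB.
Let h2 : diff_compat mul D d2 e2 := dasi_compat2 hB.

Lemma mul_dual d e u : diff_compat mul D d e ->
  (mul u \o e = (e \o mul u) + mul (d u))%VF.
Proof.
move=> h; apply/lfunP => x.
by rewrite add_lfunE !comp_lfunE (dc_right h) addrC.
Qed.

Lemma lft_mul_dual d e u t : diff_compat mul D d e ->
  lft (mul u) (lft e t) = lft e (lft (mul u) t) + lft (mul (d u)) t.
Proof. by move=> h; rewrite -!lftM -lftD -mul_dual. Qed.

Lemma rgt_mul_dual d e u t : diff_compat mul D d e ->
  rgt (mul u) (rgt e t) = rgt e (rgt (mul u) t) + rgt (mul (d u)) t.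
Proof. by move=> h; rewrite -!rgtM -rgtD -mul_dual. Qed.

Lemma lft_coproduct d e a : diff_compat mul D d e ->
  lft d (D a) = rgt e (D a) + D (d a).
Proof. by move=> h; rewrite lftE rgtE (dc_coleft h). Qed.

Lemma rgt_coproduct d e a : diff_compat mul D d e ->
  rgt d (D a) = lft e (D a) + D (d a).
Proof. by move=> h; rewrite lftE rgtE (dc_coright h). Qed.

(** (L_u^l - L_u^r) Delta w is symmetric in u and w; solved for one term, to
    serve as a rewriting rule at chosen u and w. *)
Lemma coproduct_sym u w :
  lft (mul u) (D w) = rgt (mul u) (D w) + lft (mul w) (D u) - rgt (mul w) (D u).
Proof.
have := asi_compat2 hASI u w.
rewrite -!lftE -!rgtE !(add_lfunE, opp_lfunE) lfunD lfunN.
rewrite !(lftE, rgtE) !tswap_tmap -!lftE -!rgtE.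
rewrite -(ccoalg_cocomm (asi_coalg hASI)) => /eqP.
by rewrite subr_eq => /eqP ->; abel.
Qed.

Lemma bracketE a :
  br a = ((mul (d1 a) \o d2) - (mul (d2 a) \o d1))%VF.
Proof.
apply/lfunP => x.
by rewrite induced_bracketE add_lfunE opp_lfunE !comp_lfunE.
Qed.

Lemma lft_bracket a t :
  lft (br a) t = lft (mul (d1 a)) (lft d2 t) - lft (mul (d2 a)) (lft d1 t).
Proof. by rewrite bracketE lftD lftN !lftM. Qed.

Lemma rgt_bracket a t :
  rgt (br a) t = rgt (mul (d1 a)) (rgt d2 t) - rgt (mul (d2 a)) (rgt d1 t).
Proof. by rewrite bracketE rgtD rgtN !rgtM. Qed.

(** L_(e u) = L_u d + e L_u, so L_(S a) differs from the adjoint action of a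
    only by terms in which e already stands on the left. *)
Lemma mulS a : mul (S a) =
  (br a + (e2 \o mul (d1 a)) - (e1 \o mul (d2 a)))%VF.
Proof.
have compE (e : 'End(A)) u (x : A) : (e \o mul u)%VF x = e (mul u x).
  by rewrite comp_lfunE.
apply/lfunP => x; rewrite !(add_lfunE, opp_lfunE) !compE !comp_lfunE.
rewrite induced_bracketE.
rewrite (lfunD mul) (lfunN mul) add_lfunE opp_lfunE (dc_left h1) (dc_left h2).
abel.
Qed.

Lemma lft_mulS a t : lft (mul (S a)) t =
  lft (br a) t + lft e2 (lft (mul (d1 a)) t) - lft e1 (lft (mul (d2 a)) t).
Proof. by rewrite mulS !(lftD, lftN) !lftM. Qed.

Lemma rgt_mulS a t : rgt (mul (S a)) t =
  rgt (br a) t + rgt e2 (rgt (mul (d1 a)) t) - rgt e1 (rgt (mul (d2 a)) t).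
Proof. by rewrite mulS !(rgtD, rgtN) !rgtM. Qed.

Lemma cobracket_lr a :
  delta a = lft e1 (rgt e2 (D a)) - lft e2 (rgt e1 (D a)).
Proof. by rewrite cobracketE !tmap_lft_rgt. Qed.

(** On a coproduct, S acts on either side as the cobracket up to sign, plus
    terms in which e stands on the left. *)
Lemma lft_S a :
  lft S (D a) = lft e2 (D (d1 a)) - lft e1 (D (d2 a)) - delta a.
Proof.
rewrite cobracket_lr lftD lftN !lftM.
rewrite (lft_coproduct _ h1) (lft_coproduct _ h2) !lfunD; abel.
Qed.

Lemma rgt_S a :
  rgt S (D a) = rgt e2 (D (d1 a)) - rgt e1 (D (d2 a)) + delta a.
Proof.
rewrite cobracket_lr rgtD rgtN !rgtM.
rewrite (rgt_coproduct _ h1) (rgt_coproduct _ h2) !lfunD !lft_rgtC; abel.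
Qed.

Lemma coproduct_mul a b :
  D (mul a b) = lft (mul b) (D a) + rgt (mul a) (D b).
Proof. by rewrite lftE rgtE (asi_compat1 hASI). Qed.

Lemma coproduct_bracket a b :
  D (br a b) = lft (mul (d2 b)) (D (d1 a)) + rgt (mul (d1 a)) (D (d2 b))
     - lft (mul (d1 b)) (D (d2 a)) - rgt (mul (d2 a)) (D (d1 b)).
Proof. rewrite induced_bracketE lfunD lfunN !coproduct_mul; abel. Qed.

(** The rules that move e1 and e2 to the left of multiplications, with left
    actions before right ones. *)
Let e_outE :=
  (fun u t => lft_mul_dual u t h1, fun u t => lft_mul_dual u t h2,
   fun u t => rgt_mul_dual u t h1, fun u t => rgt_mul_dual u t h2,
   fun u t => esym (lft_rgtC (mul u) e1 t),
   fun u t => esym (lft_rgtC (mul u) e2 t),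
   fun u => lft_rgtC e1 (mul u), fun u => lft_rgtC e2 (mul u),
   lft_rgtC e1 e1, lft_rgtC e1 e2, lft_rgtC e2 e1, lft_rgtC e2 e2).

Let d_coproductE :=
  (fun a => lft_coproduct a h1, fun a => lft_coproduct a h2,
   fun a => rgt_coproduct a h1, fun a => rgt_coproduct a h2).

Let addE (f g : 'End(tens A A)) t : (f + g) t = f t + g t.
Proof. exact: add_lfunE. Qed.

Let subE (f g : 'End(tens A A)) t : (f - g) t = f t - g t.
Proof. by rewrite addE opp_lfunE. Qed.

(** * The defects of the compatibility conditions *)

Definition mixed_defect a b :=
  (rgt (mul b) - lft (mul b)) (lft S (D a)) + lft (mul (S a)) (D b).

(** Both sides are normal forms once [coproduct_sym] has removed the terms
    L_u^l Delta w with u an expression in b and w an expression in a. *)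
Lemma cobracket_mul_defect a b :
  delta (mul a b) - (lft (mul a) (delta b) + lft (mul b) (delta a)
     + rgt (br a) (D b) + rgt (br b) (D a)) = - mixed_defect a b.
Proof.
rewrite /mixed_defect add_lfunE opp_lfunE lft_S lft_mulS.
rewrite !cobracket_lr coproduct_mul !lft_bracket !rgt_bracket !d_coproductE.
rewrite !(lfunD, lfunN) !e_outE !(lfunD, lfunN).
rewrite (coproduct_sym b a) (coproduct_sym b (d1 a)) (coproduct_sym b (d2 a)).
rewrite (coproduct_sym (d1 b) (d2 a)) (coproduct_sym (d2 b) (d1 a)).
rewrite !(lfunD, lfunN).
rewrite (coproduct_sym (d1 b) a) (coproduct_sym (d2 b) a).
rewrite !(lfunD, lfunN).
abel.
Qed.

Lemma coproduct_bracket_defect a b :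
  D (br a b) - ((lft (br a) + rgt (br a)) (D b)
    + (lft (mul b) - rgt (mul b)) (delta a)) = - mixed_defect a b.
Proof.
rewrite /mixed_defect lft_S lft_mulS !add_lfunE !opp_lfunE.
rewrite !cobracket_lr coproduct_bracket !lft_bracket !rgt_bracket !d_coproductE.
rewrite !(lfunD, lfunN) !e_outE !(lfunD, lfunN).
rewrite (coproduct_sym b a) (coproduct_sym b (d1 a)) (coproduct_sym b (d2 a)).
rewrite (coproduct_sym (d1 b) (d2 a)) (coproduct_sym (d2 b) (d1 a)).
rewrite !(lfunD, lfunN).
abel.
Qed.

Definition cocycle_defect a b :=
  (lft (br a) (rgt S (D b)) - lft S (rgt (br a) (D b)))
  - (lft (br b) (rgt S (D a)) - lft S (rgt (br b) (D a)))
  - (lft (mul (S a)) (rgt S (D b)) - lft S (rgt (mul (S a)) (D b)))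
  + (lft (mul (S b)) (rgt S (D a)) - lft S (rgt (mul (S b)) (D a)))
  + (lft (mul (S a)) (delta b) + rgt (mul (S a)) (delta b))
  - (lft (mul (S b)) (delta a) + rgt (mul (S b)) (delta a)).

(** [lft_S] and [rgt_S] isolate the values of the cobracket in
    [cocycle_defect]: those multiplied by S a or S b cancel each other, the others
    cancel the adjoint terms of the cocycle condition.  By [mulS] all e stand on
    the left in what remains, so no commutator arises, and the coefficient of
    each word in e1 and e2 vanishes by [coproduct_sym]. *)
Lemma cobracket_bracket_defect a b :
  delta (br a b) - (lft (br a) (delta b) + rgt (br a) (delta b)
    - (lft (br b) (delta a) + rgt (br b) (delta a))) = - cocycle_defect a b.
Proof.
rewrite /cocycle_defect.
rewrite -!(lft_rgtC S) !lft_S !rgt_S !(lfunD, lfunN) !lft_mulS !rgt_mulS.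
rewrite (cobracket_lr (br a b)) coproduct_bracket !(lfunD, lfunN) !e_outE.
rewrite (coproduct_sym (d1 b) (d1 a)) (coproduct_sym (d2 b) (d2 a)).
rewrite (coproduct_sym (d1 b) (d2 a)) (coproduct_sym (d2 b) (d1 a)).
rewrite !(lfunD, lfunN).
abel.
Qed.

(** * The criterion *)

Lemma Poisson_bialgebra_defects :
  is_Poisson_bialgebra br mul delta D <->
  forall a b, mixed_defect a b = 0 /\ cocycle_defect a b = 0.
Proof.
split=> [hP a b | h0].
- split; apply: oppr_inj; rewrite oppr0.
    by rewrite -coproduct_bracket_defect !(lftE, rgtE) (pbi_Delta_br hP) subrr.
  rewrite -cobracket_bracket_defect (liebi_cocycle (pbi_lie hP)).
  by rewrite !(lftE, rgtE) !(addE, subE) subrr.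
have hPa := induced_Poisson_algebra (dasi_alg hB).
have hPc := induced_Poisson_coalgebra (dasi_coalg hB).
split=> // [|a b|a b]; first split.
- exact: poisson_lie hPa.
- exact: poissonco_lie hPc.
- move=> a b; apply/eqP; rewrite -subr_eq0 !addE -!lftE -!rgtE.
  by rewrite cobracket_bracket_defect (h0 a b).2 oppr0.
- apply/eqP; rewrite -subr_eq0 -!lftE -!rgtE.
  by rewrite cobracket_mul_defect (h0 a b).1 oppr0.
- apply/eqP; rewrite -subr_eq0 -!lftE -!rgtE.
  by rewrite coproduct_bracket_defect (h0 a b).1 oppr0.
Qed.

Lemma mixed_defectE a b : mixed_defect a b =
  (tmap \1 (mul b) - tmap (mul b) \1) (tmap S \1 (D a))
  + tmap (mul (S a)) \1 (D b).
Proof. by rewrite /mixed_defect !(lftE, rgtE). Qed.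

Lemma cocycle_defectE a b : cocycle_defect a b =
  (tmap (br a) S - tmap S (br a)) (D b)
  - (tmap (br b) S - tmap S (br b)) (D a)
  - (tmap (mul (S a)) S - tmap S (mul (S a))) (D b)
  + (tmap (mul (S b)) S - tmap S (mul (S b))) (D a)
  + (tmap (mul (S a)) \1 + tmap \1 (mul (S a)))
      ((tmap e1 e2 - tmap e2 e1) (D b))
  - (tmap (mul (S b)) \1 + tmap \1 (mul (S b)))
      ((tmap e1 e2 - tmap e2 e1) (D a)).
Proof.
rewrite /cocycle_defect -!lftE -!rgtE !cobracketE !subE !addE.
by rewrite !tmap_lft_rgt.
Qed.

Lemma defects_vanish :
    (forall a b : A, mul (e2 (d1 a)) b = mul (e1 (d2 a)) b) ->
    (forall a, tmap (e2 \o d1)%VF \1 (D a) = tmap (e1 \o d2)%VF \1 (D a)) ->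
  forall a b, mixed_defect a b = 0 /\ cocycle_defect a b = 0.
Proof.
move=> hmul hD.
have mulS0 a : mul (S a) = 0.
  apply/lfunP => x; rewrite zero_lfunE add_lfunE opp_lfunE !comp_lfunE.
  by rewrite lfunD lfunN add_lfunE opp_lfunE hmul subrr.
have lftS0 a : lft S (D a) = 0 by rewrite lftD lftN !lftE hD subrr.
have rgtS0 a : rgt S (D a) = 0.
  rewrite (ccoalg_cocomm (asi_coalg hASI)) rgtE -tswap_tmap -lftE lftS0.
  exact: linear0.
have lft0 t : lft (0 : 'End(A)) t = 0.
  by rewrite -(subrr (\1%VF : 'End(A))) lftD lftN subrr.
have rgt0 t : rgt (0 : 'End(A)) t = 0.
  by rewrite -(subrr (\1%VF : 'End(A))) rgtD rgtN subrr.
have lf0 f : (f : 'End(tens A A)) 0 = 0 by exact: linear0.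
move=> a b; rewrite /mixed_defect /cocycle_defect !mulS0 !lftS0 !rgtS0.
rewrite -!(lft_rgtC S) !lftS0 !(lft0, rgt0, lf0).
by split; abel.
Qed.

End Bialgebra.

Theorem theorem5p24 (F : fieldType) (charF0 : [pchar F] =i pred0)
    (A : vectType F) (mul : 'Hom(A, 'End(A))) (d1 d2 : 'End(A))
    (Delta : 'Hom(A, tens A A)) (e1 e2 : 'End(A))
    (hA : is_comm_diff_algebra mul d1 d2)
    (hC : is_cocomm_diff_coalgebra Delta e1 e2)
    (hB : is_diff_ASI_bialgebra mul Delta d1 d2 e1 e2) :
  let br := induced_bracket mul d1 d2 in
  let delta := induced_cobracket Delta e1 e2 in
  let S := ((e2 \o d1) - (e1 \o d2))%VF in
  let Id := (\1%VF : 'End(A)) in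
  (is_Poisson_bialgebra br mul delta Delta <->
   (forall a b : A,
      (tmap Id (mul b) - tmap (mul b) Id) (tmap S Id (Delta a)) +
      tmap (mul (S a)) Id (Delta b) = 0 /\
      (tmap (br a) S - tmap S (br a)) (Delta b)
      - (tmap (br b) S - tmap S (br b)) (Delta a)
      - (tmap (mul (S a)) S - tmap S (mul (S a))) (Delta b)
      + (tmap (mul (S b)) S - tmap S (mul (S b))) (Delta a)
      + (tmap (mul (S a)) Id + tmap Id (mul (S a)))
          ((tmap e1 e2 - tmap e2 e1) (Delta b))
      - (tmap (mul (S b)) Id + tmap Id (mul (S b)))
          ((tmap e1 e2 - tmap e2 e1) (Delta a)) = 0)) /\
  ((forall a b : A, mul (e2 (d1 a)) b = mul (e1 (d2 a)) b) ->
   (forall a : A,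
      tmap (e2 \o d1)%VF Id (Delta a) = tmap (e1 \o d2)%VF Id (Delta a)) ->
   is_Poisson_bialgebra br mul delta Delta).
Proof.
move=> br delta S Id; split.
  split=> [/(Poisson_bialgebra_defects hB) h0 a b | h0].
    rewrite -(mixed_defectE mul d1 d2 Delta e1 e2) -cocycle_defectE.
    exact: h0.
  apply/(Poisson_bialgebra_defects hB) => a b.
  by rewrite mixed_defectE cocycle_defectE; exact: h0.
move=> hmul hD; apply/(Poisson_bialgebra_defects hB).
exact: defects_vanish hB hmul hD.
Qed.
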